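(* Let $r>0$, let $H_1,H_2$ be the Cartan generators of the Lorentz algebra, and let $\Phi=r^{-H_2\otimes H_1}$. In the twisted algebra of differential operators on spinor fields, the Dirac operator $D=i\gamma^\mu\cdot\partial_\mu$ equals $$\tilde D=i\left(r^{-1}\gamma^1*\partial_1+r\,\gamma^2*\partial_2+r^{-1}\gamma^3*\partial_3+r\,\gamma^4*\partial_4\right).$$ Moreover, if a spinor field $\psi$ satisfies the classical Dirac equation $i\gamma^\mu\partial_\mu\psi=m\psi$, then the same $\psi$, regarded as an element of the twisted module of spinor fields, satisfies the quantum Dirac equation $\tilde D*\psi=m\psi$.
   Context: $z^1,\dots,z^4$ are complex coordinates on Minkowski space, $\partial_\mu=\partial/\partial z^\mu$, $\mathcal M$ is the algebra of functions (formal power series) in the $z^\mu$, and $m$ is a constant. Spinor fields form $\mathcal W=\mathcal M\otimes\mathbf W$, $\mathbf W=\mathbb C^4$ with standard basis $e^{(1)},\dots,e^{(4)}$. The Dirac matrices $\gamma^\mu$ act by $$\gamma^1:\ e^{(1)}\mapsto e^{(3)},\ e^{(4)}\mapsto e^{(2)};\qquad \gamma^2:\ e^{(4)}\mapsto -e^{(1)},\ e^{(2)}\mapsto e^{(3)};$$ $$\gamma^3:\ e^{(3)}\mapsto e^{(1)},\ e^{(2)}\mapsto e^{(4)};\qquad \gamma^4:\ e^{(3)}\mapsto -e^{(2)},\ e^{(1)}\mapsto e^{(4)},$$ all other basis vectors being sent to $0$. The commuting elements $H_1,H_2$ act diagonally, with the following eigenvalue pairs $(H_1,H_2)$: $z^1:(1,1)$,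 $z^2:(-1,1)$, $z^3:(-1,-1)$, $z^4:(1,-1)$; $\partial_\mu$ has the negative of the pair of $z^\mu$; $\gamma^\mu$ has the same pair as $z^\mu$; $e^{(1)}:(-1,0)$, $e^{(2)}:(1,0)$, $e^{(3)}:(0,1)$, $e^{(4)}:(0,-1)$. They act on products (of functions, of differential operators, of operators on spinor fields) by the Leibniz rule, and the action of the differential operator algebra $\mathrm{Diff}(\mathcal W)=\mathrm{Diff}(\mathcal M)\otimes\mathrm{Lin}(\mathbf W,\mathbf W)$ on $\mathcal W$ is compatible with this. The twisted operations are $A*B=(\Phi_1A)\cdot(\Phi_2B)$ for $A,B\in\mathrm{Diff}(\mathcal W)$ and $A*\psi=(\Phi_1A)\cdot(\Phi_2\psi)$ for $\psi\in\mathcal W$, where $\Phi=r^{-H_2\otimes H_1}=\Phi_1\otimes\Phi_2$. Explicitly, if $H_2X=aX$ and $H_1Y=bY$ then $X*Y=r^{-ab}X\cdot Y$, extended (bi)linearly, degree by degree in $z$. Repeated indices are summed. *)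

(* Defs.v *)
From HB Require Import structures.
From mathcomp Require Import all_boot all_order all_algebra.
From mathcomp Require Import mpoly complex.
From mathcomp Require Import boolp classical_sets functions cardinality fsbigop reals.
From mathcomp Require Import zify.
Set Implicit Arguments. Unset Strict Implicit. Unset Printing Implicit Defensive.
Import Order.TTheory GRing.Theory Num.Theory.
Local Open Scope ring_scope.

(* The 1-based index n = 1, ..., 4 as an element of 'I_4 = {0, ..., 3}. *)
Definition ix (n : nat) : 'I_4 := inord n.-1.

Variant cartan := H1 | H2.

(* The H-eigenvalues of the coordinates z^1, ..., z^4. *)
Definition zweight (h : cartan) (mu : 'I_4) : int :=
  match h with
  | H1 => [:: 1; -1; -1; 1]`_mu
  | H2 => [:: 1; 1; -1; -1]`_mu
  end.

(* The H-eigenvalues of the basis spinors e^(1), ..., e^(4). *)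
Definition sweight (h : cartan) (i : 'I_4) : int :=
  match h with
  | H1 => [:: -1; 1; 0; 0]`_i
  | H2 => [:: 0; 0; 1; -1]`_i
  end.

(* The H-eigenvalue of the monomial z^k, by the Leibniz rule. *)
Definition zdeg (h : cartan) (k : 'X_{1..4}) : int :=
  \sum_(mu < 4) zweight h mu *+ k mu.

(* The H-eigenvalue of the monomial spinor z^k e^(i). *)
Definition weight (h : cartan) (i : 'I_4) (k : 'X_{1..4}) : int :=
  zdeg h k + sweight h i.

Section Spinors.
Variable R : realType.
Local Notation C := R[i].

(* Formal power series in z^1, ..., z^4: [f k] is the coefficient of z^k.
   The regular module C^o makes series and spinors C-modules pointwise. *)
Definition series := 'X_{1..4} -> C^o.

Definition mulS (f g : series) : series := fun k =>
  \sum_(l : 'X_{1..4 < (mdeg k).+1} | (l <= k)%MM) f l * g (k - l)%MM.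

Definition pdS (mu : 'I_4) (f : series) : series := fun k =>
  f (k + U_(mu))%MM *+ (k mu).+1.

(* M (x) C^4: [psi i] is the coefficient of e^(i+1). *)
Definition spinor := 'I_4 -> series.

Definition mulop (f : series) (psi : spinor) : spinor := fun i => mulS f (psi i).

Definition pdop (mu : 'I_4) (psi : spinor) : spinor := fun i => pdS mu (psi i).

Definition linop (M : 'M[C]_4) (psi : spinor) : spinor := fun i k =>
  \sum_j M i j * psi j k.

(* Diff(W) = Diff(M) (x) Lin(C^4, C^4), realised as the subalgebra of End(W)
   generated by the multiplications by series, the partial derivatives and
   Lin(C^4, C^4); this loses nothing, since the action of Diff(W) on W is
   faithful in characteristic 0. *)
Inductive is_diffop : (spinor -> spinor) -> Prop :=
| is_diffop_mul f : is_diffop (mulop f)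
| is_diffop_pd mu : is_diffop (pdop mu)
| is_diffop_lin M : is_diffop (linop M)
| is_diffop_add A B : is_diffop A -> is_diffop B ->
    is_diffop (fun psi => A psi + B psi)
| is_diffop_comp A B : is_diffop A -> is_diffop B ->
    is_diffop (fun psi => A (B psi)).

(* The action of H on W and, by compatibility with the action of operators
   (H.(A psi) = (H.A) psi + A (H.psi)), on operators. *)
Definition Hact (h : cartan) (psi : spinor) : spinor := fun i k =>
  (weight h i k)%:~R * psi i k.

Definition Hop (h : cartan) (A : spinor -> spinor) (psi : spinor) : spinor :=
  Hact h (A psi) - A (Hact h psi).

(* The component of psi in the a-eigenspace of H. *)
Definition wproj (h : cartan) (a : int) (psi : spinor) : spinor := fun i k =>
  if weight h i k == a then psi i k else 0.

(* The component of the operator A in the a-eigenspace of H: it keeps those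
   matrix entries of A from z^l e^(j) to z^k e^(i) for which
   weight h i k - weight h j l = a. It is an eigenvector (Hop_ocomp) and A is
   the sum of its components (ocomp_sum). *)
Definition ocomp (h : cartan) (a : int) (A : spinor -> spinor) (psi : spinor) :
    spinor := fun i k =>
  A (wproj h (weight h i k - a) psi) i k.

(* A * B = \sum_(a, b) r^(-ab) A_a B_b, with A_a the H2-component of weight a
   of A and B_b the H1-component of weight b of B, coefficient by coefficient;
   for differential operators only finitely many (a, b) contribute to each
   coefficient (twist_comp_sums), and A * B is again a differential operator
   (is_diffop_twist). On eigenvectors A * B = r^(-ab) A B (twist_comp_eigen). *)
Definition twist_comp (r : R) (A B : spinor -> spinor) (psi : spinor) : spinor :=
  fun i k => \sum_(p \in [set: int * int])
    (r ^ (- (p.1 * p.2)))%:C%C * ocomp H2 p.1 A (ocomp H1 p.2 B psi) i k.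

(* A * psi = \sum_(a, b) r^(-ab) A_a psi_b, likewise (twist_app_sums, twist_app_eigen). *)
Definition twist_app (r : R) (A : spinor -> spinor) (psi : spinor) : spinor :=
  fun i k => \sum_(p \in [set: int * int])
    (r ^ (- (p.1 * p.2)))%:C%C * ocomp H2 p.1 A (wproj H1 p.2 psi) i k.

(* [sums F v]: F has finite support and its values add up to v. *)

Section Sums.
Variable I : choiceType.
Definition sums (F : I -> C) (v : C) :=
  exists2 X : seq I, uniq X &
    (forall p : I, p \notin X -> F p = 0) /\ \sum_(p <- X) F p = v.

Lemma sums_widen (F : I -> C) v (X Y : seq I) : uniq X -> uniq Y -> (forall p : I, p \notin X -> F p = 0) ->
  {subset X <= Y} -> \sum_(p <- X) F p = v -> \sum_(p <- Y) F p = v.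
Proof.
move=> uX uY zX sXY <-; rewrite (bigID (fun p => p \in X)) /=.
rewrite [X in _ + X]big1; last by move=> p; exact: zX.
rewrite addr0 -big_filter; apply: perm_big; apply: uniq_perm => //.
  exact: filter_uniq.
by move=> p; rewrite mem_filter; case pX: (p \in X) => //=; exact: sXY.
Qed.

Lemma sumsE F v : sums F v -> \sum_(p \in [set: I]) F p = v.
Proof.
move=> [X uX [zX <-]]; rewrite (@fsbigE _ _ _ _ _ X) //.
- by apply: eq_bigl => p; rewrite in_setT.
- by move=> p _; exact: zX.
Qed.

Lemma eq_sums F G v : F =1 G -> sums F v -> sums G v.
Proof. by move=> /funext ->. Qed.

Lemma sums0 : sums (fun=> 0) 0.
Proof. by exists [::] => //; rewrite big_nil. Qed.

Lemma sums_delta p0 c : sums (fun p => if p == p0 then c else 0) c.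
Proof.
exists [:: p0] => //; split=> [p|]; last by rewrite big_seq1 eqxx.
by rewrite inE => /negbTE ->.
Qed.

Lemma sums_add F G v w : sums F v -> sums G w -> sums (fun p => F p + G p) (v + w).
Proof.
move=> [X uX [zX eX]] [Y uY [zY eY]].
have uXY : uniq (undup (X ++ Y)) by exact: undup_uniq.
exists (undup (X ++ Y)) => //; split=> [p|].
  by rewrite mem_undup mem_cat negb_or => /andP[pX pY]; rewrite zX // zY // addr0.
rewrite big_split /=; congr (_ + _).
- by apply: (sums_widen uX) => // p; rewrite mem_undup mem_cat => ->.
- by apply: (sums_widen uY) => // p; rewrite mem_undup mem_cat orbC => ->.
Qed.

Lemma sums_big (J : Type) (s : seq J) (F : J -> I -> C) (v : J -> C) :
  (forall j, sums (F j) (v j)) -> sums (fun p => \sum_(j <- s) F j p) (\sum_(j <- s) v j).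
Proof.
move=> H; elim: s => [|j s IH].
  by rewrite big_nil; apply: eq_sums sums0 => p; rewrite big_nil.
by rewrite big_cons; apply: eq_sums (sums_add (H j) IH) => p; rewrite big_cons.
Qed.
End Sums.

Definition down (k : 'X_{1..4}) : seq 'X_{1..4} :=
  [seq val l | l <- enum {: 'X_{1..4 < (mdeg k).+1}} & (val l <= k)%MM].

Lemma down_uniq k : uniq (down k).
Proof. by rewrite (map_inj_uniq val_inj) filter_uniq // enum_uniq. Qed.

Lemma lem_mdeg (l k : 'X_{1..4}) : (l <= k)%MM -> (mdeg l <= mdeg k)%N.
Proof.
by move=> /mnm_lepP H; rewrite !mdegE; apply: leq_sum => i _.
Qed.

Lemma mem_down k l : (l \in down k) = (l <= k)%MM.
Proof.
apply/mapP/idP => [[l']|lk]; first by rewrite mem_filter => /andP[? _] ->.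
have dl : (mdeg l < (mdeg k).+1)%N by rewrite ltnS lem_mdeg.
by exists (BMultinom dl) => //; rewrite mem_filter /= lk mem_enum.
Qed.

Lemma mulSE f g k : mulS f g k = \sum_(l <- down k) f l * g (k - l)%MM.
Proof. by rewrite /mulS /down big_map big_filter big_enum_cond. Qed.

Lemma sum_down (k l : 'X_{1..4}) (P : pred 'X_{1..4}) (h : 'X_{1..4} -> 'X_{1..4})
    (F : 'X_{1..4} -> C) :
  injective h -> (forall b, (b \in down l) && P b = (b \in map h (down k))) ->
  \sum_(b <- down l | P b) F b = \sum_(b <- down k) F (h b).
Proof.
move=> hI H; rewrite -big_filter -[RHS](big_map h xpredT F).
apply: perm_big; apply: uniq_perm; rewrite ?filter_uniq ?down_uniq //.
  by rewrite map_inj_uniq // down_uniq.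
by move=> b; rewrite mem_filter andbC H.
Qed.

Lemma sum_down_triple k (G : 'X_{1..4} -> 'X_{1..4} -> 'X_{1..4} -> C) :
  \sum_(b <- down k) \sum_(d <- down (k - b)%MM) G b d (k - b - d)%MM =
  \sum_(e <- down k) \sum_(b <- down e) G b (e - b)%MM (k - e)%MM.
Proof.
have -> : \sum_(e <- down k) \sum_(b <- down e) G b (e - b)%MM (k - e)%MM =
   \sum_(e <- down k) \sum_(b <- down k | (b <= e)%MM) G b (e - b)%MM (k - e)%MM.
  rewrite big_seq [RHS]big_seq; apply: eq_bigr => e; rewrite mem_down => ek.
  rewrite (@sum_down e k _ id) // => b; rewrite map_id !mem_down.
  by rewrite andb_idl // => be; exact: lepm_trans ek.
rewrite (exchange_big_dep xpredT) //=.
rewrite big_seq [RHS]big_seq; apply: eq_bigr => b; rewrite mem_down => bk.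
rewrite (@sum_down (k - b)%MM k _ (fun d => (b + d)%MM)) //=.
- by apply: eq_bigr => d _; rewrite submDA [(b + d)%MM]addmC addmK addmC.
- by exact: addmI.
move=> e; rewrite mem_down; apply/andP/mapP => [[ek be]|[d]].
- exists (e - b)%MM; last by rewrite addmC submK.
  rewrite mem_down; apply/mnm_lepP => i; rewrite !mnmBE.
  by apply: leq_sub2r; move/mnm_lepP: ek.
- rewrite mem_down => dk ->; rewrite lem_addr; split=> //.
  apply/mnm_lepP => i; rewrite mnmDE; move/mnm_lepP: dk => /(_ i).
  by move/mnm_lepP: bk => /(_ i); rewrite mnmBE; lia.
Qed.

Lemma mulSA f g h : mulS f (mulS g h) = mulS (mulS f g) h.
Proof.
apply/funext => k; rewrite !mulSE.
transitivity (\sum_(b <- down k) \sum_(d <- down (k - b)%MM)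
    f b * (g d * h (k - b - d)%MM)).
  by apply: eq_bigr => b _; rewrite mulSE mulr_sumr.
rewrite (sum_down_triple k (fun b d e => f b * (g d * h e))).
by apply: eq_bigr => e _; rewrite mulSE mulr_suml; apply: eq_bigr => b _; rewrite mulrA.
Qed.

Lemma pdS_mul mu f g : pdS mu (mulS f g) = mulS (pdS mu f) g + mulS f (pdS mu g).
Proof.
apply/funext => k; rewrite /pdS -[RHS]/(mulS (pdS mu f) g k + mulS f (pdS mu g) k) !mulSE.
set U := U_(mu)%MM.
have H (b : 'X_{1..4}) : (b <= k + U)%MM ->
    f b * g (k + U - b)%MM *+ (k mu).+1 = f b * g (k + U - b)%MM *+ b mu
       + f b * g (k + U - b)%MM *+ (k + U - b)%MM mu.
  move=> /mnm_lepP /(_ mu); rewrite mnmBE mnmDE mnm1E eqxx => bk.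
  by rewrite -mulrnDr; congr (_ *+ _); lia.
rewrite -sumrMnl (eq_big_seq _ (fun b bk => H b (etrans (esym (mem_down _ _)) bk))).
rewrite big_split /=; congr (_ + _).
- rewrite (bigID (fun b : 'X_{1..4} => b mu == 0%N)) /= big1 ?add0r; last first.
    by move=> b /eqP ->.
  rewrite (@sum_down k _ _ (fun b => (b + U)%MM)); last 2 first.
  + exact: addIm.
  + move=> e; rewrite mem_down -lep1mP -/U; apply/andP/mapP => [[ek Ue]|[b]].
      exists (e - U)%MM; last by rewrite submK.
      rewrite mem_down; apply/mnm_lepP => i; rewrite mnmBE.
      by move/mnm_lepP: ek => /(_ i); rewrite mnmDE; lia.
    rewrite mem_down => /mnm_lepP bk ->; rewrite lem_addl; split=> //.
    by apply/mnm_lepP => i; rewrite !mnmDE leq_add2r.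
  apply: eq_bigr => b _; rewrite /pdS mnmDE mnm1E eqxx addn1 -mulrnAl.
  by congr (_ * g _); apply/mnmP => i; rewrite !mnmBE !mnmDE subnDr.
- rewrite (bigID (fun b : 'X_{1..4} => (b <= k)%MM)) /= addrC big_seq_cond big1 ?add0r.
    rewrite (@sum_down k _ _ id) //.
      rewrite big_seq [RHS]big_seq; apply: eq_bigr => b; rewrite mem_down => bk.
      have e : (k + U - b = k - b + U)%MM.
        apply/mnmP => i; rewrite mnmBE !mnmDE mnmBE.
        by move/mnm_lepP: bk => /(_ i); lia.
      by rewrite e /pdS mnmDE mnm1E eqxx addn1 mulrnAr.
    move=> b; rewrite map_id !mem_down andb_idl // => bk.
    by apply: lepm_trans bk _; exact: lem_addr.
  move=> b /andP[]; rewrite mem_down => /mnm_lepP bkU /negP bk.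
  suff -> : (k + U - b)%MM mu = 0%N by rewrite mulr0n.
  have [//|n0] := eqVneq ((k + U - b)%MM mu) 0%N.
  case: bk; apply/mnm_lepP => i; move: n0 (bkU i).
  rewrite mnmBE !mnmDE !mnm1E; case: (mu =P i) => [<-|_]; last by rewrite addn0.
  by rewrite eqxx; lia.
Qed.


Lemma mulSDr f g1 g2 : mulS f (g1 + g2) = mulS f g1 + mulS f g2.
Proof.
apply/funext => k; rewrite -[RHS]/(mulS f g1 k + mulS f g2 k) !mulSE -big_split /=.
by apply: eq_bigr => l _; rewrite -mulrDr.
Qed.

Definition constS (c : C) : series := fun k => if k == 0%MM then c else 0.

Lemma mul_constS c f k : mulS (constS c) f k = c * f k.
Proof.
rewrite mulSE (bigD1_seq (0%MM : 'X_{1..4})) ?down_uniq //=; last first.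
  by rewrite mem_down; apply/mnm_lepP => i; rewrite mnm0E.
rewrite big1 ?addr0; first by rewrite /constS eqxx subm0.
by move=> l /negbTE l0; rewrite /constS l0 mul0r.
Qed.

(* Operators (d/dz)^a (x) E_ij, with their weights. *)
Inductive mono : (cartan -> int) -> (spinor -> spinor) -> Prop :=
| mono_lin i j : mono (fun h => sweight h i - sweight h j) (linop (delta_mx i j))
| mono_pd mu p Q : mono p Q ->
    mono (fun h => p h - zweight h mu) (fun psi => pdop mu (Q psi)).

(* Finite sums of f (d/dz)^a (x) E_ij. *)
Inductive nform : (spinor -> spinor) -> Prop :=
| nform_term f p Q : mono p Q -> nform (fun psi => mulop f (Q psi))
| nform_add A B : nform A -> nform B -> nform (fun psi => A psi + B psi).

Lemma eq_nform A B : (forall psi i k, A psi i k = B psi i k) -> nform A -> nform B.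
Proof.
move=> H; suff -> : A = B by [].
by apply/funext => psi; apply/funext => i; apply/funext => k.
Qed.

Lemma mono_is_diffop p Q : mono p Q -> is_diffop Q.
Proof.
elim=> [i j|mu {}p {}Q _ IH]; first exact: is_diffop_lin.
exact: is_diffop_comp (is_diffop_pd mu) IH.
Qed.

Lemma nform_is_diffop A : nform A -> is_diffop A.
Proof.
elim=> [f p Q /mono_is_diffop HQ|{}A B _ HA _ HB].
- exact: is_diffop_comp (is_diffop_mul f) HQ.
- exact: is_diffop_add.
Qed.

Lemma linop_delta i j psi l k :
  linop (delta_mx i j) psi l k = if l == i then psi j k else 0.
Proof.
rewrite /linop (bigD1 j) //= big1 => [|j' /negbTE j'j]; rewrite !mxE ?eqxx ?j'j ?andbF ?mul0r //.
by rewrite addr0 andbT; case: (l == i); rewrite ?mul1r ?mul0r.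
Qed.

Lemma nform_big (n : nat) (F : 'I_n.+1 -> spinor -> spinor) :
  (forall j, nform (F j)) -> nform (fun psi => \sum_j F j psi).
Proof.
elim: n F => [|n IH] F H.
  by apply: eq_nform (H ord0) => psi i k; rewrite big_ord1.
apply: eq_nform (nform_add (H ord0) (IH (fun j => F (lift ord0 j)) (fun j => H _))).
by move=> psi i k; rewrite [in RHS]big_ord_recl.
Qed.

Lemma spinor_sumE (J : Type) (s : seq J) (F : J -> spinor) i k :
  (\sum_(j <- s) F j) i k = \sum_(j <- s) F j i k.
Proof. by elim/big_rec2: _ => // j y1 y2 _ <-. Qed.

Lemma nform_id : nform id.
Proof.
apply: eq_nform (@nform_big 3 (fun j psi => mulop (constS 1) (linop (delta_mx j j) psi)) _).
  move=> psi i k; rewrite spinor_sumE (bigD1 i) //= big1 => [|j /negbTE ji].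
    by rewrite /mulop mul_constS linop_delta eqxx mul1r addr0.
  by rewrite /mulop mul_constS linop_delta eq_sym ji mulr0.
by move=> j; apply: nform_term (mono_lin _ _).
Qed.

Lemma nform_mul f A : nform A -> nform (fun psi => mulop f (A psi)).
Proof.
elim=> [g p Q HQ|{}A B _ HA _ HB].
- apply: eq_nform (nform_term (mulS f g) HQ) => psi i k.
  by rewrite /mulop mulSA.
- apply: eq_nform (nform_add HA HB) => psi i k.
  by rewrite /mulop /= mulSDr.
Qed.

Lemma pdSD mu f g : pdS mu (f + g) = pdS mu f + pdS mu g.
Proof. by apply/funext => k; rewrite /pdS -[RHS]mulrnDl. Qed.

Lemma nform_pd mu A : nform A -> nform (fun psi => pdop mu (A psi)).
Proof.
elim=> [g p Q HQ|{}A B _ HA _ HB].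
- apply: eq_nform (nform_add (nform_term (pdS mu g) HQ)
    (nform_term g (mono_pd mu HQ))) => psi i k.
  by rewrite /pdop /mulop pdS_mul.
- apply: eq_nform (nform_add HA HB) => psi i k.
  by rewrite /pdop pdSD.
Qed.

Lemma nform_lin M A : nform A -> nform (fun psi => linop M (A psi)).
Proof.
elim=> [g p Q HQ|{}A B _ HA _ HB].
- suff H : nform (fun psi => linop M (Q psi)).
    apply: eq_nform (nform_mul g H) => psi i k.
    rewrite /mulop /linop mulSE.
    under [RHS]eq_bigr do rewrite mulSE mulr_sumr.
    rewrite exchange_big /=; apply: eq_bigr => l _.
    by rewrite mulr_sumr; apply: eq_bigr => j _; rewrite mulrCA.
  elim: HQ => [i j|mu {}p {}Q HQ IH].
    apply: eq_nform (@nform_big 3 (fun l psi => mulop (constS (M l i))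
      (linop (delta_mx l j) psi)) _).
      move=> psi l k; rewrite spinor_sumE (bigD1 l) //= big1 => [|l' /negbTE l'l].
        rewrite /mulop mul_constS linop_delta eqxx addr0.
        rewrite -[RHS]/(\sum_i' M l i' * linop (delta_mx i j) psi i' k) (bigD1 i) //= big1.
          by rewrite linop_delta eqxx addr0.
        by move=> i' /negbTE i'i; rewrite linop_delta i'i mulr0.
      by rewrite /mulop mul_constS linop_delta eq_sym l'l mulr0.
    by move=> l; apply: nform_term (mono_lin _ _).
  apply: eq_nform (nform_pd mu IH) => psi i k.
  by rewrite /pdop /pdS /linop -sumrMnl; apply: eq_bigr => j _; rewrite mulrnAr.
- apply: eq_nform (nform_add HA HB) => psi i k.
  rewrite -[LHS]/(linop M (A psi) i k + linop M (B psi) i k) /linop -big_split /=.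
  by apply: eq_bigr => j _; rewrite -mulrDr.
Qed.

Lemma is_diffop_nform A : is_diffop A -> nform A.
Proof.
suff H B : is_diffop A -> nform B -> nform (fun psi => A (B psi)).
  by move=> HA; exact: H HA nform_id.
move=> HA; elim: HA B => [f|mu|M|A1 A2 _ H1 _ H2|A1 A2 _ H1 _ H2] B HB.
- exact: nform_mul.
- exact: nform_pd.
- exact: nform_lin.
- exact: nform_add (H1 _ HB) (H2 _ HB).
- exact: H1 _ (H2 _ HB).
Qed.

Lemma zdegD h k l : zdeg h (k + l)%MM = zdeg h k + zdeg h l.
Proof.
by rewrite /zdeg -big_split; apply: eq_bigr => mu _; rewrite mnmDE mulrnDr.
Qed.

Lemma zdegU h mu : zdeg h U_(mu)%MM = zweight h mu.
Proof.
rewrite /zdeg (bigD1 mu) //= big1 => [|nu /negbTE nm]; rewrite mnm1E.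
  by rewrite eqxx addr0.
by rewrite eq_sym nm.
Qed.

Lemma zdegB h k l : (l <= k)%MM -> zdeg h (k - l)%MM = zdeg h k - zdeg h l.
Proof. by move=> lk; rewrite -[in RHS](submK lk) zdegD addrK. Qed.

Lemma mono_wproj h p Q a psi i k : mono p Q ->
  Q (wproj h a psi) i k = wproj h (a + p h) (Q psi) i k.
Proof.
move=> HQ; elim: HQ i k => [i j|mu {}p {}Q _ IH] l k.
- rewrite /wproj linop_delta [in RHS]linop_delta; case: (l =P i) => [->|_]; last by rewrite if_same.
  by congr (if _ then _ else _); rewrite /weight; lia.
- rewrite /pdop /pdS IH /wproj.
  have -> : (weight h l (k + U_(mu))%MM == a + p h) = (weight h l k == a + (p h - zweight h mu)).
    by rewrite /weight zdegD zdegU; lia.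
  by case: ifP => //; rewrite mul0rn.
Qed.

Lemma ocomp_mulop h f p Q a psi i k : mono p Q ->
  ocomp h a (fun psi => mulop f (Q psi)) psi i k =
  \sum_(l <- down k) if a == zdeg h l + p h then f l * Q psi i (k - l)%MM else 0.
Proof.
move=> HQ; rewrite /ocomp /mulop mulSE big_seq [RHS]big_seq.
apply: eq_bigr => l; rewrite mem_down => lk.
rewrite (mono_wproj _ _ _ _ _ HQ) /wproj /weight zdegB //.
have -> : (zdeg h k - zdeg h l + sweight h i == zdeg h k + sweight h i - a + p h)
   = (a == zdeg h l + p h) by lia.
by case: ifP => // _; rewrite mulr0.
Qed.

Lemma ocompD h a A B psi i k :
  ocomp h a (fun psi => A psi + B psi) psi i k = ocomp h a A psi i k + ocomp h a B psi i k.
Proof. by []. Qed.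

Lemma ocomp_sums h A psi i k : is_diffop A ->
  sums (fun a => ocomp h a A psi i k) (A psi i k).
Proof.
move=> /is_diffop_nform; elim=> [f p Q HQ|{}A B _ HA _ HB]; last exact: sums_add HA HB.
rewrite /mulop mulSE; apply: eq_sums (sums_big _ _) => [a|l].
  by rewrite (ocomp_mulop _ _ _ _ _ _ HQ).
exact: sums_delta.
Qed.

Lemma ocomp_sum h A psi i k : is_diffop A ->
  \sum_(a \in [set: int]) ocomp h a A psi i k = A psi i k.
Proof. by move=> HA; exact: sumsE (ocomp_sums _ _ _ _ HA). Qed.

Lemma mono_ocomp h p Q a B psi i k : mono p Q ->
  Q (ocomp h a B psi) i k = ocomp h (a + p h) (fun psi => Q (B psi)) psi i k.
Proof.
move=> HQ; rewrite /ocomp.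
have E (chi : spinor) : Q chi i k = Q (wproj h (weight h i k - p h) chi) i k.
  by rewrite (mono_wproj _ _ _ _ _ HQ) /wproj subrK eqxx.
rewrite E [RHS]E; congr (Q _ i k).
apply/funext => j; apply/funext => l; rewrite /wproj; case: eqP => // ->.
by congr (B (wproj _ _ _) _ _); lia.
Qed.

Section Twist.
Variable r : R.

Lemma twist_aux (f : series) (p2 p1 : int) A : nform A ->
  exists2 T, nform T & forall (psi : spinor) i k,
  sums (fun p : int * int => (r ^ (- (p.1 * p.2)))%:C%C *
   \sum_(l <- down k) if p.1 == zdeg H2 l + p2 then
       f l * ocomp H1 (p.2 + p1) A psi i (k - l)%MM else 0) (T psi i k).
Proof.
elim=> [g p Q HQ|{}A B _ [T1 N1 HA] _ [T2 N2 HB]]; last first.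
  exists (fun psi => T1 psi + T2 psi); first exact: nform_add.
  move=> chi i k; apply: eq_sums (sums_add (HA _ _ _) (HB _ _ _)) => q /=.
  rewrite -mulrDr -big_split /=; congr (_ * _); apply: eq_bigr => l _.
  by case: ifP => _; rewrite ?addr0 // ocompD mulrDr.
pose c (b d : 'X_{1..4}) : C :=
  (r ^ (- ((zdeg H2 b + p2) * (zdeg H1 d + p H1 - p1))))%:C%C * (f b * g d).
pose h : series := fun e => \sum_(b <- down e) c b (e - b)%MM.
exists (fun psi => mulop h (Q psi)); first exact: nform_term HQ.
move=> chi i k; rewrite /mulop mulSE.
under eq_bigr do rewrite mulr_suml.
rewrite -(sum_down_triple k (fun b d e => c b d * Q chi i e)).
apply: eq_sums (sums_big _ (fun b => sums_big _ (fun d =>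
  sums_delta (zdeg H2 b + p2, zdeg H1 d + p H1 - p1) _))) => -[a1 a2] /=.
rewrite mulr_sumr; apply: eq_bigr => b _.
rewrite (ocomp_mulop _ _ _ _ _ _ HQ).
have [->|ne] := eqVneq a1 (zdeg H2 b + p2); last first.
  by rewrite mulr0 big1 // => d _; rewrite xpair_eqE (negbTE ne).
rewrite !mulr_sumr; apply: eq_bigr => d _; rewrite xpair_eqE eqxx /=.
have -> : (a2 == zdeg H1 d + p H1 - p1) = (a2 + p1 == zdeg H1 d + p H1) by lia.
case: eqP => [e|_]; last by rewrite !mulr0.
have -> : a2 = zdeg H1 d + p H1 - p1 by lia.
by rewrite /c !mulrA.
Qed.

Lemma twist_comp_sums A B : is_diffop A -> is_diffop B ->
  exists2 T, is_diffop T & forall (psi : spinor) i k,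
  sums (fun p : int * int => (r ^ (- (p.1 * p.2)))%:C%C *
     ocomp H2 p.1 A (ocomp H1 p.2 B psi) i k) (T psi i k).
Proof.
move=> /is_diffop_nform HA HB.
suff [T NT HT] : exists2 T, nform T & forall (psi : spinor) i k,
  sums (fun p : int * int => (r ^ (- (p.1 * p.2)))%:C%C *
     ocomp H2 p.1 A (ocomp H1 p.2 B psi) i k) (T psi i k).
  by exists T => //; exact: nform_is_diffop.
elim: HA => [f p Q HQ|{}A A' _ [T1 N1 H1'] _ [T2 N2 H2']]; last first.
  exists (fun psi => T1 psi + T2 psi); first exact: nform_add.
  move=> chi i k; apply: eq_sums (sums_add (H1' _ _ _) (H2' _ _ _)) => q /=.
  by rewrite -mulrDr.
have NB : nform (fun psi => Q (B psi)).
  exact/is_diffop_nform/is_diffop_comp/HB/mono_is_diffop/HQ.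
have [T NT HT] := twist_aux f (p H2) (p H1) NB.
exists T => // psi i k; apply: eq_sums (HT psi i k) => q /=.
rewrite (ocomp_mulop _ _ _ _ _ _ HQ); congr (_ * _); apply: eq_bigr => l _.
by rewrite (mono_ocomp _ _ _ _ _ _ HQ).
Qed.

Lemma is_diffop_twist A B : is_diffop A -> is_diffop B -> is_diffop (twist_comp r A B).
Proof.
move=> HA HB; have [T HT H] := twist_comp_sums HA HB.
suff -> : twist_comp r A B = T by [].
apply/funext => psi; apply/funext => i; apply/funext => k.
exact: sumsE (H psi i k).
Qed.


Lemma twist_app_sums A psi i k : is_diffop A ->
  exists v, sums (fun p : int * int => (r ^ (- (p.1 * p.2)))%:C%C *
     ocomp H2 p.1 A (wproj H1 p.2 psi) i k) v.
Proof.
move=> /is_diffop_nform; elim=> [f p Q HQ|{}A B _ [v Hv] _ [w Hw]]; last first.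
  by exists (v + w); apply: eq_sums (sums_add Hv Hw) => q /=; rewrite -mulrDr.
pose a l := zdeg H2 l + p H2; pose b l := weight H1 i (k - l)%MM - p H1.
exists (\sum_(l <- down k) (r ^ (- (a l * b l)))%:C%C * (f l * Q psi i (k - l)%MM)).
apply: eq_sums (sums_big _ (fun l => sums_delta (a l, b l) _)) => -[a1 b1] /=.
rewrite (ocomp_mulop _ _ _ _ _ _ HQ) mulr_sumr; apply: eq_bigr => l _.
rewrite xpair_eqE (mono_wproj _ _ _ _ _ HQ) /wproj.
have -> : (weight H1 i (k - l)%MM == b1 + p H1) = (b1 == b l) by rewrite /b; lia.
by case: eqP => [->|_]; case: eqP => [->|_]; rewrite ?mulr0.
Qed.

End Twist.

Lemma is_diffopZ A c psi : is_diffop A -> A (c *: psi) = c *: A psi.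
Proof.
move=> HA; elim: HA psi => [f|mu|M|{}A B _ HA _ HB|{}A B _ HA _ HB] psi; last 2 first.
- by rewrite HA HB scalerDr.
- by rewrite HB HA.
all: apply/funext => i; apply/funext => k.
- rewrite -[RHS]/(c * mulS f (psi i) k) /mulop !mulSE mulr_sumr.
  by apply: eq_bigr => l _; rewrite mulrCA.
- by rewrite -[RHS]/(c * (psi i (k + U_(mu))%MM *+ _)) mulrnAr.
- rewrite -[RHS]/(c * \sum_j M i j * psi j k) mulr_sumr.
  by apply: eq_bigr => j _; rewrite mulrCA.
Qed.

Lemma Hact_wproj h a psi : Hact h (wproj h a psi) = a%:~R *: wproj h a psi.
Proof.
apply/funext => i; apply/funext => k; rewrite /Hact -[RHS]/(_ * _) /wproj.
by case: eqP => [->//|_]; rewrite !mulr0.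
Qed.

Lemma Hact_eigen h a psi i k : Hact h psi = a%:~R *: psi ->
  weight h i k != a -> psi i k = 0.
Proof.
move=> /(congr1 (fun f : spinor => f i k)) E; rewrite -subr_eq0 => ne.
apply/eqP; move: E; rewrite /Hact -[RHS]/(_ * psi i k) => /eqP.
by rewrite -subr_eq0 -mulrBl -intrB mulf_eq0 intr_eq0 (negbTE ne).
Qed.

Lemma Hop_ocomp h a A psi : is_diffop A ->
  Hop h (ocomp h a A) psi = a%:~R *: ocomp h a A psi.
Proof.
move=> HA; apply/funext => i; apply/funext => k.
rewrite -[LHS]/((weight h i k)%:~R * ocomp h a A psi i k - ocomp h a A (Hact h psi) i k).
rewrite -[RHS]/(a%:~R * ocomp h a A psi i k) /ocomp.
set w := weight h i k; have -> : wproj h (w - a) (Hact h psi) = (w - a)%:~R *: wproj h (w - a) psi.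
  rewrite -Hact_wproj; apply/funext => j; apply/funext => l; rewrite /Hact /wproj.
  by case: ifP; rewrite ?mulr0.
rewrite is_diffopZ // -[X in _ - X]/(_ * _) -mulrBl -intrB; congr (_%:~R * _).
by rewrite subKr.
Qed.

Lemma ocomp_eigen h a A : is_diffop A ->
  (forall psi, Hop h A psi = a%:~R *: A psi) ->
  forall c psi i k, ocomp h c A psi i k = if c == a then A psi i k else 0.
Proof.
move=> HA E.
have Z c psi i k : c != a -> ocomp h c A psi i k = 0.
  rewrite -subr_eq0 => ne; rewrite /ocomp; set w := weight h i k.
  have /(congr1 (fun f : spinor => f i k)) := E (wproj h (w - c) psi).
  rewrite /Hop Hact_wproj is_diffopZ //; set x := A _.
  rewrite -[LHS]/(w%:~R * x i k - (w - c)%:~R * x i k) -[RHS]/(a%:~R * x i k).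
  move/eqP; rewrite -mulrBl -intrB -subr_eq0 -mulrBl -intrB subKr mulf_eq0 intr_eq0.
  by rewrite (negbTE ne) => /eqP.
move=> c psi i k; case: eqP => [->|/eqP/Z//].
rewrite -(ocomp_sum h psi i k HA).
have H : sums (fun c => ocomp h c A psi i k) (ocomp h a A psi i k).
  by apply: eq_sums (sums_delta a _) => c'; case: eqP => [->//|/eqP/Z ->].
by rewrite (sumsE H).
Qed.

Lemma twist_comp_eigen r A B a b : is_diffop A -> is_diffop B ->
  (forall psi, Hop H2 A psi = a%:~R *: A psi) ->
  (forall psi, Hop H1 B psi = b%:~R *: B psi) ->
  forall psi, twist_comp r A B psi = (r ^ (- (a * b)))%:C%C *: A (B psi).
Proof.
move=> HA HB EA EB psi; apply/funext => i; apply/funext => k.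
rewrite -[RHS]/(_ * A (B psi) i k) /twist_comp; apply: sumsE.
apply: eq_sums (sums_delta (a, b) _) => -[a1 b1] /=; rewrite xpair_eqE.
rewrite (ocomp_eigen HA EA); case: eqP => [->|_]; last by rewrite mulr0.
have -> : ocomp H1 b1 B psi = (b1 == b)%:R *: B psi.
  apply/funext => j; apply/funext => l; rewrite (ocomp_eigen HB EB) -[RHS]/(_ * _).
  by case: eqP; rewrite ?mul1r ?mul0r.
rewrite is_diffopZ // -[((b1 == b)%:R *: _) i k]/((b1 == b)%:R * A (B psi) i k).
by case: eqP => [->|_]; rewrite ?mul1r // mul0r mulr0.
Qed.

Lemma twist_app_eigen r A a b psi : is_diffop A ->
  (forall phi, Hop H2 A phi = a%:~R *: A phi) ->
  Hact H1 psi = b%:~R *: psi ->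
  twist_app r A psi = (r ^ (- (a * b)))%:C%C *: A psi.
Proof.
move=> HA EA Epsi; apply/funext => i; apply/funext => k.
rewrite -[RHS]/(_ * A psi i k) /twist_app; apply: sumsE.
apply: eq_sums (sums_delta (a, b) _) => -[a1 b1] /=; rewrite xpair_eqE.
rewrite (ocomp_eigen HA EA); case: eqP => [->|_]; last by rewrite mulr0.
have -> : wproj H1 b1 psi = (b1 == b)%:R *: psi.
  apply/funext => j; apply/funext => l; rewrite /wproj -[RHS]/(_ * psi j l).
  have [->|ne] := eqVneq b1 b.
    by case: eqP => [_|/eqP/(Hact_eigen Epsi) ->]; rewrite mul1r.
  rewrite mul0r; case: eqP => // e; apply: Hact_eigen Epsi _.
  by rewrite e.
rewrite is_diffopZ // -[((b1 == b)%:R *: _) i k]/((b1 == b)%:R * A psi i k).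
by case: eqP => [->|_]; rewrite ?mul1r // mul0r mulr0.
Qed.

Record diffop := Diffop { dop :> spinor -> spinor; dopP : is_diffop dop }.

HB.instance Definition _ := gen_eqMixin diffop.
HB.instance Definition _ := gen_choiceMixin diffop.

Lemma diffop_eq (A B : diffop) : (forall psi i k, A psi i k = B psi i k) -> A = B.
Proof.
case: A B => [A HA] [B HB] /= H; have E : A = B.
  by apply/funext => psi; apply/funext => i; apply/funext => k.
by subst B; congr Diffop; exact: Prop_irrelevance.
Qed.

Lemma is_diffop_scale (c : C) A : is_diffop A -> is_diffop (fun psi => c *: A psi).
Proof.
move=> HA; suff -> : (fun psi => c *: A psi) = (fun psi => linop c%:M (A psi)).
  by apply: is_diffop_comp HA; exact: is_diffop_lin.
apply/funext => psi; apply/funext => i; apply/funext => k.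
rewrite -[LHS]/(c * A psi i k) /linop (bigD1 i) //= big1 => [|j /negbTE ji].
  by rewrite mxE eqxx addr0.
by rewrite mxE eq_sym ji mul0r.
Qed.

Definition dscale (c : C) (A : diffop) : diffop := Diffop (is_diffop_scale c (dopP A)).
Definition dadd (A B : diffop) : diffop := Diffop (is_diffop_add (dopP A) (dopP B)).
Definition dmul (A B : diffop) : diffop := Diffop (is_diffop_comp (dopP A) (dopP B)).
Definition dlin (M : 'M[C]_4) : diffop := Diffop (is_diffop_lin M).
Definition dpd (mu : 'I_4) : diffop := Diffop (is_diffop_pd mu).

Lemma daddA : associative dadd.
Proof. by move=> A B D; apply: diffop_eq => psi i k; exact: addrA. Qed.
Lemma daddC : commutative dadd.
Proof. by move=> A B; apply: diffop_eq => psi i k; exact: addrC. Qed.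
Lemma dadd0 : left_id (dlin 0) dadd.
Proof.
move=> A; apply: diffop_eq => psi i k; rewrite -[RHS]add0r; congr (_ + _).
by rewrite /= /linop big1 // => j _; rewrite mxE mul0r.
Qed.
Lemma daddN : left_inverse (dlin 0) (dscale (-1)) dadd.
Proof.
move=> A; apply: diffop_eq => psi i k.
rewrite /= /linop big1 => [|j _]; last by rewrite mxE mul0r.
by rewrite scaleN1r addNr.
Qed.
HB.instance Definition _ := GRing.isZmodule.Build diffop daddA daddC dadd0 daddN.

Lemma dscaleA (a b : C) (A : diffop) : dscale a (dscale b A) = dscale (a * b) A.
Proof. by apply: diffop_eq => psi i k; rewrite /= scalerA. Qed.
Lemma dscale1 : left_id 1 dscale.
Proof. by move=> A; apply: diffop_eq => psi i k; rewrite /= scale1r. Qed.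
Lemma dscaleDr : right_distributive dscale +%R.
Proof. by move=> c A B; apply: diffop_eq => psi i k; rewrite /= scalerDr. Qed.
Lemma dscaleDl (A : diffop) : {morph dscale^~ A : a b / a + b >-> a + b}.
Proof. by move=> a b; apply: diffop_eq => psi i k; rewrite /= scalerDl. Qed.
HB.instance Definition _ :=
  GRing.Zmodule_isLmodule.Build C diffop dscaleA dscale1 dscaleDr dscaleDl.

Definition twist_dmul (r : R) (A B : diffop) : diffop :=
  Diffop (is_diffop_twist r (dopP A) (dopP B)).

(* The elementary matrix sending e^(j) to e^(i). *)
Definition elem_mx (i j : nat) : 'M[C]_4 := delta_mx (ix i) (ix j).

Definition gamma_mx (mu : 'I_4) : 'M[C]_4 :=
  [:: elem_mx 3 1 + elem_mx 2 4;
      - elem_mx 1 4 + elem_mx 3 2;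
      elem_mx 1 3 + elem_mx 4 2;
      - elem_mx 2 3 + elem_mx 4 1]`_mu.

Definition gamma (mu : 'I_4) : diffop := dlin (gamma_mx mu).

Definition dirac : diffop := 'i%C *: \sum_(mu < 4) dmul (gamma mu) (dpd mu).

Definition twisted_dirac (r : R) : diffop :=
  'i%C *: ( r%:C%C^-1 *: twist_dmul r (gamma (ix 1)) (dpd (ix 1))
          + r%:C%C    *: twist_dmul r (gamma (ix 2)) (dpd (ix 2))
          + r%:C%C^-1 *: twist_dmul r (gamma (ix 3)) (dpd (ix 3))
          + r%:C%C    *: twist_dmul r (gamma (ix 4)) (dpd (ix 4))).

Lemma Hop_dpd h mu psi : Hop h (dpd mu) psi = (- zweight h mu)%:~R *: dpd mu psi.
Proof.
apply/funext => i; apply/funext => k; rewrite -[RHS]/(_ * dpd mu psi i k).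
rewrite -[LHS]/((weight h i k)%:~R * (psi i (k + U_(mu))%MM *+ (k mu).+1)
  - ((weight h i (k + U_(mu))%MM)%:~R * psi i (k + U_(mu))%MM) *+ (k mu).+1).
rewrite -mulrnAr -mulrBl -intrB; congr (_%:~R * _).
by rewrite /weight zdegD zdegU; lia.
Qed.

Lemma Hop_gamma h mu psi : Hop h (gamma mu) psi = (zweight h mu)%:~R *: gamma mu psi.
Proof.
apply/funext => i; apply/funext => k.
rewrite -[RHS]/(_ * \sum_j gamma_mx mu i j * psi j k).
rewrite -[LHS]/((weight h i k)%:~R * (\sum_j gamma_mx mu i j * psi j k)
  - \sum_j gamma_mx mu i j * ((weight h j k)%:~R * psi j k)).
rewrite !mulr_sumr -sumrB; apply: eq_bigr => j _.
rewrite [X in _ - X]mulrCA -mulrBl -intrB.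
have [->|ne] := eqVneq (gamma_mx mu i j) 0; first by rewrite !mul0r !mulr0.
congr (_%:~R * _).
have -> : weight h i k - weight h j k = sweight h i - sweight h j by rewrite /weight; lia.
move: ne; rewrite /gamma_mx /elem_mx.
case: mu => -[|[|[|[|//]]]] ? /=; rewrite !mxE -!val_eqE /= !inordK //=;
  case: i => -[|[|[|[|//]]]] ? /=; case: j => -[|[|[|[|//]]]] ? //=;
  rewrite ?addr0 ?oppr0 ?eqxx //; by case: h.
Qed.

End Spinors.

(* Main.v *)
(** [gamma^mu] and [d_mu] are eigenvectors whose weights cancel, so the twist
    rescales [gamma^mu d_mu] by [r] or [r^-1], which the coefficients of the
    twisted Dirac operator undo.  The sum [D] therefore has [H2]-weight [0], and
    twisting does not change the action of an operator of [H2]-weight [0]. *)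
Require Import Defs.
From mathcomp Require Import all_boot all_order all_algebra.
From mathcomp Require Import complex boolp functions reals.
Import Order.TTheory GRing.Theory Num.Theory.
Local Open Scope ring_scope.

Lemma is_diffopD (R : realType) (A : spinor R -> spinor R) (phi psi : spinor R) :
  is_diffop A -> A (phi + psi) = A phi + A psi.
Proof.
move=> HA; elim: HA phi psi => [f|mu|M|{}A B _ HA _ HB|{}A B _ HA _ HB] phi psi.
- by apply/funext => i; exact: mulSDr.
- by apply/funext => i; exact: pdSD.
- apply/funext => i; apply/funext => k.
  rewrite -[RHS]/(linop M phi i k + linop M psi i k) /linop -big_split /=.
  by apply: eq_bigr => j _; rewrite -mulrDr.
- by rewrite HA HB addrACA.
- by rewrite HB HA.
Qed.

Lemma HactD (R : realType) h (phi psi : spinor R) :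
  Hact h (phi + psi) = Hact h phi + Hact h psi.
Proof. by apply/funext => i; apply/funext => k; rewrite /Hact -[LHS]/(_ * (_ + _)) mulrDr. Qed.

Lemma HactZ (R : realType) h c (psi : spinor R) : Hact h (c *: psi) = c *: Hact h psi.
Proof. by apply/funext => i; apply/funext => k; rewrite /Hact -[LHS]/(_ * (_ * _)) mulrCA. Qed.

(** Leibniz rule for commutators with [H]: [[H, AB] = [H, A] B + A [H, B]]. Linearity of [A], hence
    [is_diffop A], is needed to expand the second term; the two copies of [A (H (B psi))] then
    cancel. *)
Lemma Hop_comp_eigen (R : realType) h (a b : int) (A B : spinor R -> spinor R) :
  is_diffop A ->
  (forall psi, Hop h A psi = a%:~R *: A psi) ->
  (forall psi, Hop h B psi = b%:~R *: B psi) ->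
  forall psi, Hop h (A \o B) psi = (a + b)%:~R *: A (B psi).
Proof.
move=> HA EA EB psi; rewrite intrD scalerDl.
rewrite -[X in X + _]EA -is_diffopZ // -EB /Hop /=.
by rewrite -[- B _]scaleN1r is_diffopD // is_diffopZ // scaleN1r subrKA.
Qed.

Lemma Hop_dirac (R : realType) h (psi : spinor R) : Hop h (dirac R) psi = 0.
Proof.
(* An arbitrary index list permits induction, [Hop h] being additive in the operator. *)
suff H : forall s, Hop h (\sum_(mu <- s) dmul (gamma R mu) (dpd R mu) : diffop R) psi = 0.
  rewrite /Hop -[dirac R (Hact h psi)]/(_ *: _) -[dirac R psi]/(_ *: _).
  by rewrite HactZ -scalerBr [X in _ *: X]H scaler0.
elim=> [|mu s IH].
  (* The zero of [diffop] is [dlin 0], so its action has to be computed. *)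
  have E phi : (0 : diffop R) phi = 0.
    apply/funext => i; apply/funext => k.
    by rewrite -[LHS]/(linop 0 phi i k) /linop big1 // => j _; rewrite mxE mul0r.
  rewrite big_nil /Hop !E subr0.
  by apply/funext => i; apply/funext => k; exact: mulr0.
rewrite big_cons /Hop -![(_ + _ : diffop R) _]/(_ + _) HactD opprD addrACA [X in _ + X]IH addr0.
have := Hop_comp_eigen _ _ _ _ _ _ (dopP (gamma R mu)) (Hop_gamma h mu) (Hop_dpd h mu) psi.
by rewrite subrr scale0r.
Qed.

(** Only the pairs [(0, b)] survive, with factor [r ^ 0 = 1], leaving the sum of [A psi_b] over the
    [H1]-components of [psi]. As [psi] may have infinitely many, [A] cannot simply be pulled out of
    the sum. *)
Lemma twist_app_weight0 (R : realType) (r : R) (A : spinor R -> spinor R) psi :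
  is_diffop A -> (forall phi, Hop H2 A phi = 0) -> twist_app r A psi = A psi.
Proof.
move=> HA EA; have {}EA phi : Hop H2 A phi = 0%:~R *: A phi by rewrite EA scale0r.
apply/funext => i; apply/funext => k; apply: sumsE.
have [X uX [zX <-]] := ocomp_sums H1 psi i k HA.
(* At a coefficient of weight [w], the part of [A] of [H1]-weight [a] sees only the part of [psi] of
   weight [w - a]. So [g] turns the finite decomposition of [A] into the sum over [b]. *)
pose w := weight H1 i k; pose g (a : int) : int * int := (0, w - a).
have gI : injective g by move=> a b [/addrI/oppr_inj].
exists (map g X); first by rewrite map_inj_uniq.
split=> [[a b]|]; last first.
  rewrite big_map; apply: eq_bigr => a _.
  by rewrite (ocomp_eigen HA EA) /= mul0r oppr0 expr0z mul1r.
move=> nX; rewrite (ocomp_eigen HA EA) /=; case: eqP => [a0|_]; last by rewrite mulr0.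
have -> : A (wproj H1 b psi) i k = ocomp H1 (w - b) A psi i k.
  by rewrite /ocomp subKr.
rewrite zX ?mulr0 //; apply: contra nX => nX.
by apply/mapP; exists (w - b); rewrite // /g subKr a0.
Qed.

(** The minus sign in the exponent of the twist cancels that of the weight of [d_mu]. *)
Lemma twist_gamma_dpd (R : realType) (r : R) mu :
  twist_dmul r (gamma R mu) (dpd R mu) =
  (r ^ (zweight H2 mu * zweight H1 mu))%:C%C *: dmul (gamma R mu) (dpd R mu).
Proof.
apply: diffop_eq => psi i k /=.
rewrite (twist_comp_eigen r (dopP (gamma R mu)) (dopP (dpd R mu))
  (Hop_gamma H2 mu) (Hop_dpd H1 mu)).
by rewrite mulrN opprK.
Qed.

Lemma dirac_twisted (R : realType) (r : R) : r != 0 -> dirac R = twisted_dirac r.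
Proof.
move=> r0; have rC0 : r%:C%C != 0 by rewrite fmorph_eq0.
rewrite /dirac /twisted_dirac !big_ord_recr big_ord0 /= add0r !twist_gamma_dpd.
have E (j : 'I_4) n : val j = n -> j = ix n.+1.
  by move=> <-; rewrite /ix inord_val.
rewrite (E (widen_ord _ (widen_ord _ (widen_ord _ ord_max))) 0%N erefl).
rewrite (E (widen_ord _ (widen_ord _ ord_max)) 1%N erefl).
rewrite (E (widen_ord _ ord_max) 2%N erefl) (E ord_max 3%N erefl).
(* The products of the [H2]- and [H1]-weights are 1, -1, 1, -1, so the twist contributes [r],
   [r^-1], [r], [r^-1]. *)
rewrite /zweight /ix !inordK //= !mulr1 !mulN1r ?mul1r ?opprK !exprN1 !expr1z.
by rewrite !fmorphV !scalerA mulVf // mulfV // !scale1r.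
Qed.

Theorem mainTheorem8 (R : realType) (r : R) (m : R[i]) (hr : 0 < r) :
  dirac R = twisted_dirac r /\
  forall psi : spinor R,
    dirac R psi = m *: psi -> twist_app r (twisted_dirac r) psi = m *: psi.
Proof.
have E := dirac_twisted _ _ (lt0r_neq0 hr).
(* The classical equation turns the goal into [D * psi = D psi]. *)
split=> // psi <-; rewrite -E.
by apply: twist_app_weight0 => [|phi]; [exact: dopP | exact: Hop_dirac].
Qed.
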